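(* Suppose that the following hold. (i) $\mathcal J:\mathcal X\to[0,+\infty]$ is proper, convex and weakly-* lower semicontinuous, and its non-empty sublevel sets $\{u\in\mathcal X:\mathcal J(u)\le C\}$ are weakly-* sequentially compact. (ii) $\mathcal H(\cdot\mid\cdot):\mathcal Y\times\mathcal Y\to[0,+\infty]$ is proper, convex in its first argument, weakly-* lower semicontinuous jointly in both arguments, and $\mathcal H(v\mid f)=0$ if and only if $v=f$. (iii) The operators $A,A^l,A^u:\mathcal X\to\mathcal Y$ are weak-* to weak-* continuous. Then the optimisation problem $$\min_{u\in\mathcal X,\ v\in\mathcal Y}\ \frac1\alpha\mathcal H(v\mid f)+\mathcal J(u)\quad\text{subject to}\quad A^lu\le v\le A^uu$$ has a solution.
   Context: $\mathcal X=\mathcal U^*$ and $\mathcal Y=\mathcal V^*$ are duals of Banach lattices $\mathcal U$, $\mathcal V$, equipped with the dual norm and the dual partial order: $y\ge0$ iff $\langle y,v\rangle\ge0$ for all $v\in\mathcal V$, $v\ge 0$ (similarly on $\mathcal X$). $A,A^l,A^u:\mathcal X\to\mathcal Y$ are bounded linear operators, $A$ is regular (a difference of two positive operators), and $A^l\le A\le A^u$, meaning $A^lu\le Au\le A^uu$ for all $u\ge0$. $\bar f\in\mathcal Y$ is the exact data, and it is assumed that there is a non-negative $\mathcal J$-minimising solution $u^\dagger_{\mathcal J}$: $Au^\dagger_{\mathcal J}=\bar f$, $u^\dagger_{\mathcal J}\ge0$, and $\mathcal J(u^\dagger_{\mathcal J})\le\mathcal J(u)$ for all $u$ with $Au=\bar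 f$. $f\in\mathcal Y$ is the noisy datum with $\mathcal H(\bar f\mid f)\le\delta<\infty$, and $\alpha>0$ is fixed. *)

(* Defs.v *)
From HB Require Import structures.
From mathcomp Require Import all_boot all_order all_algebra.
From mathcomp Require Import all_classical all_reals all_analysis.

Set Implicit Arguments.
Unset Strict Implicit.
Unset Printing Implicit Defensive.

Import Order.TTheory GRing.Theory Num.Theory.
Import numFieldNormedType.Exports.

Local Open Scope classical_set_scope.
Local Open Scope ring_scope.

(* The order is part of the mixin, since the MathComp hierarchy has no join of
   normed modules with order structures below NumDomain. The lattice modulus |x|
   is bl_sup x (- x). *)
HB.mixin Record isBanachLattice (R : realType) V of CompleteNormedModule R V := {
  bl_le : rel V ;
  bl_sup : V -> V -> V ;
  bl_inf : V -> V -> V ;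
  bl_le_refl : reflexive bl_le ;
  bl_le_anti : antisymmetric bl_le ;
  bl_le_trans : transitive bl_le ;
  bl_supP : forall x y z, bl_le (bl_sup x y) z = bl_le x z && bl_le y z ;
  bl_infP : forall x y z, bl_le z (bl_inf x y) = bl_le z x && bl_le z y ;
  bl_le_add : forall x y z : V, bl_le x y -> bl_le (x + z) (y + z) ;
  bl_le_scale : forall (a : R) (x y : V),
    0 <= a -> bl_le x y -> bl_le (a *: x) (a *: y) ;
  bl_le_norm : forall x y : V,
    bl_le (bl_sup x (- x)) (bl_sup y (- y)) -> `|x| <= `|y|
}.

#[short(type="banachLatticeType")]
HB.structure Definition BanachLattice (R : realType) :=
  { V of isBanachLattice R V & CompleteNormedModule R V }.

HB.instance Definition _ (R : realType) (V : banachLatticeType R) :=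
  Order.Le_isPOrder.Build ring_display (BanachLattice.sort V)
    (@bl_le_refl R V) (@bl_le_anti R V) (@bl_le_trans R V).
HB.instance Definition _ (R : realType) (V : banachLatticeType R) :=
  Order.POrder_isMeetSemilattice.Build ring_display (BanachLattice.sort V)
    (fun x y z => @bl_infP R V y z x).
HB.instance Definition _ (R : realType) (V : banachLatticeType R) :=
  Order.POrder_isJoinSemilattice.Build ring_display (BanachLattice.sort V)
    (@bl_supP R V).

Section DualSpace.
Context {R : realType} {V : normedModType R}.

Definition dual_pred : {pred V -> R^o} :=
  fun f => `[< linear f /\ continuous f >].

Record dual := Dual { dual_val :> V -> R^o; dual_valP : dual_val \in dual_pred }.

HB.instance Definition _ := [isSub for dual_val].
HB.instance Definition _ := [Choice of dual by <:].

Lemma dual_submod_closed : submod_closed dual_pred.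
Proof.
split.
  apply/asboolP; split; first by move=> a x y; rewrite scaler0 addr0.
  by move=> x; exact: cvg_cst.
move=> a f g /asboolP[lf cf] /asboolP[lg cg]; apply/asboolP; split.
  move=> b x y; rewrite /= !fctE lf lg !scalerDr !scalerA.
  by rewrite [a * b]mulrC addrACA.
by move=> x; apply: cvgD; [apply: cvgZr; exact: cf | exact: cg].
Qed.

HB.instance Definition _ :=
  GRing.isSubmodClosed.Build R (V -> R^o) dual_pred dual_submod_closed.
HB.instance Definition _ := [SubChoice_isSubLmodule of dual by <:].

Lemma dual_linear (f : dual) : linear f.
Proof. by have /asboolP[] := dual_valP f. Qed.

HB.instance Definition _ (f : dual) :=
  GRing.isLinear.Build R V R^o _ (dual_val f) (dual_linear f).

Lemma dual_continuous (f : dual) : continuous f.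
Proof. by have /asboolP[] := dual_valP f. Qed.

Definition dual_norm (f : dual) : R :=
  sup [set `|f x| | x in [set x : V | `|x| <= 1]].

Lemma dual_norm_has_sup (f : dual) :
  has_sup [set `|f x| | x in [set x : V | `|x| <= 1]].
Proof.
split; first by exists `|f 0|, 0 => //=; rewrite normr0.
have /linear_boundedP/pinfty_ex_gt0[r r0 fr] :=
  continuous_linear_bounded (f := f) 0 (@dual_continuous f 0).
exists r => _ [x /= x1 <-]; apply: le_trans (fr x) _.
by rewrite -[leRHS]mulr1 ler_wpM2l// ltW.
Qed.

Lemma dual_norm_ge (f : dual) x : `|x| <= 1 -> `|f x| <= dual_norm f.
Proof.
by move=> x1; apply: ub_le_sup; [exact: (dual_norm_has_sup f).2|exists x].
Qed.

Lemma dual_norm_le (f : dual) c :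
  (forall x, `|x| <= 1 -> `|f x| <= c) -> dual_norm f <= c.
Proof.
move=> fc; apply: ge_sup; first exact: (dual_norm_has_sup f).1.
by move=> _ [x /= /fc ? <-].
Qed.

Lemma dual_normD (f g : dual) : dual_norm (f + g) <= dual_norm f + dual_norm g.
Proof.
apply: dual_norm_le => x x1; apply: le_trans (ler_normD (f x) (g x)) _.
by apply: lerD; exact: dual_norm_ge.
Qed.

Lemma dual_normZ_le (l : R) (f : dual) : dual_norm (l *: f) <= `|l| * dual_norm f.
Proof.
apply: dual_norm_le => x x1; rewrite (normrM l (f x)).
by apply: ler_wpM2l => //; exact: dual_norm_ge.
Qed.

Lemma dual_normZ (l : R) (f : dual) : dual_norm (l *: f) = `|l| * dual_norm f.
Proof.
apply/eqP; rewrite eq_le dual_normZ_le /=.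
have [->|l0] := eqVneq l 0.
  rewrite normr0 mul0r; apply: le_trans (dual_norm_ge (x := 0) _ _) => //.
  by rewrite normr0.
rewrite -ler_pdivlMl ?normr_gt0// -normfV.
by apply: le_trans (dual_normZ_le _ _); rewrite scalerA mulVf// scale1r.
Qed.

Lemma dual_norm0_eq0 (f : dual) : dual_norm f = 0 -> f = 0.
Proof.
move=> f0; apply/val_inj/funext => x /=.
have [->|x0] := eqVneq x 0; first by rewrite linear0.
have : `|f (`|x|^-1 *: x)| <= 0.
  rewrite -f0; apply: dual_norm_ge.
  by rewrite normrZ normfV normr_id mulVf// normr_eq0.
rewrite normr_le0 linearZ /= scaler_eq0 invr_eq0 normr_eq0 (negbTE x0) /=.
by move/eqP.
Qed.

HB.instance Definition _ :=
  Lmodule_isNormed.Build R dual dual_normD dual_normZ dual_norm0_eq0.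

End DualSpace.
Arguments dual {R} V.

Section DualOrder.
Context {R : realType} {V : banachLatticeType R}.

Definition dual_le (y z : dual V) : bool :=
  `[< forall v : V, 0 <= v -> y v <= z v >].

Lemma dual_le_refl : reflexive dual_le.
Proof. by move=> y; apply/asboolP. Qed.

Lemma dual_le_trans : transitive dual_le.
Proof.
move=> z y w /asboolP yz /asboolP zw; apply/asboolP => v v0.
exact: le_trans (yz _ v0) (zw _ v0).
Qed.

Lemma dual_le_anti : antisymmetric dual_le.
Proof.
move=> y z /andP[/asboolP yz /asboolP zy]; apply/val_inj/funext => v /=.
have pos w : 0 <= w -> y w = z w.
  by move=> w0; apply/eqP; rewrite eq_le yz // zy.
set p : V := Order.join v 0.
have p0 : 0 <= p by exact: leUr.
have pv0 : 0 <= p - v by rewrite -(subrr v); apply: bl_le_add; exact: leUl.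
by rewrite -[v](subKr p) linearB [in RHS]linearB /= pos// (pos _ pv0).
Qed.

HB.instance Definition _ := Order.Le_isPOrder.Build ring_display (dual V)
  dual_le_refl dual_le_anti dual_le_trans.

Lemma dual_leP (y z : dual V) :
  y <= z <-> forall v : V, 0 <= v -> y v <= z v.
Proof. by split => [/asboolP|?]; last exact/asboolP. Qed.

Lemma dual_ge0P (y : dual V) : 0 <= y <-> forall v : V, 0 <= v -> 0 <= y v.
Proof. exact: dual_leP. Qed.

End DualOrder.

(* dual V carries its norm topology; weak_star V is the same set with the
   topology of pointwise convergence on V. *)
Definition weak_star {R : realType} (V : normedModType R) : Type :=
  initial_topology (fun f : dual V => (f : {ptws V -> R^o})).

HB.instance Definition _ (R : realType) (V : normedModType R) :=
  Topological.copy (weak_star V)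
    (initial_topology (fun f : dual V => (f : {ptws V -> R^o}))).

Lemma weak_star_cvgP (R : realType) (V : normedModType R)
    (F : set_system (weak_star V)) (FF : Filter F) (y : weak_star V) :
  F --> y <->
  forall v : V, (fun g : dual V => g v : R^o) @ F --> (y : dual V) v.
Proof.
split=> [Fy v|Fy B /=].
  have c : {for y, continuous (fun g : weak_star V => (g : dual V) v : R^o)}.
    apply: (@continuous_comp (weak_star V) {ptws V -> R^o} R^o
      (fun g : dual V => (g : V -> R^o)) (fun h => h v)).
      exact: initial_continuous.
    exact: (@proj_continuous V (fun _ => R^o) v).
  exact: cvg_trans (cvg_app _ Fy) c.
rewrite nbhsE => -[W [[C oC CW] Wy] WB].
apply: filterS WB _; rewrite -CW.
apply: (@pointwise_cvgP V R^o ((fun g : dual V => (g : V -> R^o)) @ F)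
  (y : dual V) _).2 Fy _ _.
by rewrite nbhsE; exists C => //; split => //; move: Wy; rewrite -CW.
Qed.

Section Operators.
Context {R : realType} {U V : banachLatticeType R}.

Definition bounded_operator (A : {linear dual U -> dual V}) : Prop :=
  bounded_near A (nbhs (0 : dual U)).

Definition positive_operator (A : {linear dual U -> dual V}) : Prop :=
  forall u : dual U, 0 <= u -> 0 <= A u.

Definition regular_operator (A : {linear dual U -> dual V}) : Prop :=
  exists P Q : {linear dual U -> dual V},
    [/\ positive_operator P, positive_operator Q & forall u, A u = P u - Q u].

Definition operator_le (A B : {linear dual U -> dual V}) : Prop :=
  forall u : dual U, 0 <= u -> A u <= B u.

Definition weak_star_continuous (A : {linear dual U -> dual V}) : Prop :=
  continuous (A : weak_star U -> weak_star V).

End Operators.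

Section ExtendedFunctionals.
Context {R : realType}.
Local Open Scope ereal_scope.

Definition proper_fun {T : Type} (F : T -> \bar R) : Prop :=
  (forall x, F x != -oo) /\ exists x, F x < +oo.

Definition convex_efun {E : lmodType R} (F : E -> \bar R) : Prop :=
  forall (t : R) (x y : E), (0 <= t <= 1)%R ->
    F (t *: x + (1 - t) *: y)%R <= t%:E * F x + (1 - t)%:E * F y.

End ExtendedFunctionals.

Definition sequentially_compact {T : topologicalType} (S : set T) : Prop :=
  forall x : nat -> T, (forall n, S (x n)) ->
    exists2 l, S l & exists2 k : nat -> nat, {homo k : m n / (m < n)%N} &
      x \o k @ \oo --> l.

Section Minimisation.
Context {R : realType}.

Definition nonneg_J_minimising {U V : banachLatticeType R}
    (A : {linear dual U -> dual V}) (J : dual U -> \bar R)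
    (fbar : dual V) (u : dual U) : Prop :=
  [/\ A u = fbar, 0 <= u & forall w, A w = fbar -> (J u <= J w)%E].

Definition minimiser_on {T : Type} (F : T -> \bar R) (D : set T) (x : T) : Prop :=
  D x /\ forall y, D y -> (F x <= F y)%E.

End Minimisation.

(* Main.v *)
Require Import Defs.
From HB Require Import structures.
From mathcomp Require Import all_boot all_order all_algebra.
From mathcomp Require Import all_classical all_reals all_analysis.
From mathcomp Require Import lra.

Set Implicit Arguments.
Unset Strict Implicit.
Unset Printing Implicit Defensive.

Import Order.TTheory GRing.Theory Num.Theory.
Import numFieldNormedType.Exports.

Local Open Scope classical_set_scope.
Local Open Scope ring_scope.

(** The proof is the direct method, in which only the [u]-components of a
    minimising sequence are compact by assumption.

    The feasible set contains [(udag, A udag)], which is a minimiser if the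
    infimum is infinite.  Otherwise the values [J u_n] are bounded along a
    minimising sequence [(u_n, v_n)], so that, after passing to a subsequence,
    [u_n] converges weak-* to some [u].  The [v_n] are controlled by the constraint
    alone: for a positive vector [w], the number [v_n w] lies between [Al u_n w]
    and [Au u_n w], and these converge to [Al u w] and [Au u w].  Every vector is
    a difference of positive ones, hence [v_n x] is bounded for each [x].

    Since the predual [V] need not be separable, [v_n] may have no weak-*
    convergent subsequence.  It does converge pointwise along an ultrafilter
    that refines the tails of the sequence, and the limit [v] is linear and
    satisfies [Al u <= v <= Au u] on positive vectors; being squeezed between two continuous functionals it is continuous,
    so it belongs to the dual ([order_interval_ultra_cvg]).  Thus [(u, v)] is a
    feasible cluster point of the minimising sequence.  A cluster point is
    enough, because lower semicontinuity is meant for the weak-* topology and not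
    for sequences: it already forces the objective at [(u, v)] down to the
    infimum ([exists_minimiser]). *)

(** * Minimising lower semicontinuous functions *)

Section LowerSemicontinuity.
Context {R : realType} {T : topologicalType}.
Implicit Types F G : T -> \bar R.
Local Open Scope ereal_scope.

Lemma lower_semicontinuous_comp {S : topologicalType} (g : S -> T) F :
  continuous g -> lower_semicontinuous F -> lower_semicontinuous (F \o g).
Proof.
move=> cg lF x a /lF[B Bgx BF]; exists (g @^-1` B); first exact: cg.
by move=> y /BF.
Qed.

Lemma lower_semicontinuousZl (c : R) F : (0 < c)%R ->
  lower_semicontinuous F -> lower_semicontinuous (fun x => c%:E * F x).
Proof.
move=> c0 lF x a; have scale y : (a%:E < c%:E * F y) = ((a / c)%:E < F y).
  by rewrite muleC -lte_pdivrMr// -EFinM.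
by rewrite scale => /lF[B Bx BF]; exists B => // y /BF; rewrite scale.
Qed.

Lemma lower_semicontinuousD F G :
  (forall x, F x != -oo) -> (forall x, G x != -oo) ->
  lower_semicontinuous F -> lower_semicontinuous G ->
  lower_semicontinuous (F \+ G).
Proof.
move=> FNy GNy lF lG x a /= aFG.
have [b [c [bF cG abc]]] :
    exists b c : R, [/\ b%:E < F x, c%:E < G x & (a = b + c)%R].
  move: aFG (FNy x) (GNy x).
  case: (F x) => [p| |//]; case: (G x) => [q| |//] apq _ _.
  - (* the gap p + q - a is shared equally between the two summands *)
    rewrite -EFinD lte_fin in apq.
    exists (p - (p + q - a) / 2)%R, (q - (p + q - a) / 2)%R.
    by rewrite !lte_fin; split; lra.
  - by exists (p - 1)%R, (a - p + 1)%R; rewrite lte_fin ltry; split => //; lra.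
  - by exists (a - q + 1)%R, (q - 1)%R; rewrite lte_fin ltry; split => //; lra.
  - by exists a, 0%R; rewrite !ltry addr0.
have [B Bx BF] := lF _ _ bF; have [C Cx CG] := lG _ _ cG.
exists (B `&` C); first exact: filterI.
by move=> y [/BF bFy /CG cGy]; rewrite abc EFinD lteD.
Qed.

(** The direct method, with cluster points in place of convergent subsequences:
    [F] exceeds any level below [F l] on a whole neighbourhood of [l], hence at
    infinitely many terms of a minimising sequence that clusters at [l]. *)
Lemma exists_minimiser F (D : set T) :
  D !=set0 -> (forall x, 0 <= F x) -> lower_semicontinuous F ->
  (forall (C : R) (x : nat -> T), (forall n, D (x n) /\ F (x n) <= C%:E) ->
     exists2 l, D l & cluster (x @ \oo) l) ->
  exists p, minimiser_on F D p.
Proof.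
move=> [x0 Dx0] F0 lF Dcpt; pose m := ereal_inf (F @` D).
have mF y : D y -> m <= F y by move=> Dy; apply: ereal_inf_lbound; exists y.
have m0 : 0 <= m by apply: le_ereal_inf_tmp => _ [y _ <-].
have [my|mNy] := eqVneq m +oo.
  by exists x0; split => // y /mF; rewrite my leye_eq => /eqP ->; rewrite leey.
have mfin : m \is a fin_num by rewrite ge0_fin_numE// ltey.
have /choice[x xP] n :
    exists y, D y /\ F y < m + (n.+1%:R^-1)%:E.
  have n0 : (0 < n.+1%:R^-1 :> R)%R by [].
  by have [_ [y Dy <-] Fy] := lb_ereal_inf_adherent n0 mfin; exists y.
have [n|l Dl clx] := Dcpt (fine m + 1)%R x.
  have [Dxn /ltW Fxn] := xP n; split => //; apply: le_trans Fxn _.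
  by rewrite EFinD fineK// leeD2l// lee_fin invf_le1 ?ler1n.
exists l; split => // y Dy; apply: le_trans (mF _ Dy).
apply/lee_addgt0Pr => e e0; rewrite leNgt; apply/negP.
rewrite -[X in X + _]fineK// -EFinD => /lF[B Bl BF].
have xnear : \forall n \near \oo, F (x n) < (fine m + e)%:E.
  near=> n; apply: (lt_le_trans (xP n).2).
  rewrite EFinD fineK// leeD2l// lee_fin ltW//.
  by near: n; exact: near_infty_natSinv_lt (PosNum e0).
have [z [/= Fz /BF]] := clx [set z | F z < (fine m + e)%:E] B xnear Bl.
by rewrite ltNge (ltW Fz).
Unshelve. all: by end_near. Qed.

(** A subsequence that converges only along a refinement [G] of the filter at
    infinity still yields a cluster point, which is the form in which
    [exists_minimiser] uses compactness. *)
Lemma cluster_subseq (x : nat -> T) (k : nat -> nat) (G : set_system nat) l :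
  ProperFilter G -> \oo `<=` G -> {homo k : m n / (m < n)%N} ->
  x \o k @ G --> l -> cluster (x @ \oo) l.
Proof.
move=> PG ooG kmono xkl A B [N _ NA] Bl.
have nk n : (n <= k n)%N.
  by elim: n => // n IH; exact: leq_ltn_trans IH (kmono _ _ (ltnSn n)).
have GA : G [set n | A (x (k n))].
  by apply: ooG; exists N => // n /= Nn; apply: NA => /=; exact: leq_trans (nk n).
have GB : G [set n | B (x (k n))] by exact: xkl.
have [n [An Bn]] := filter_ex (filterI GA GB).
by exists (x (k n)).
Qed.

End LowerSemicontinuity.

(** * Weak-* compactness of order intervals in the dual *)

Section OrderIntervals.
Context {R : realType} {V : banachLatticeType R}.

Lemma norm_join0_le (x : V) : `|Order.join x 0 : V| <= `|x|.
Proof.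
set s : V := Order.join x (- x).
have s0 : 0 <= s.
  have ss : 0 <= s + s.
    apply: (@le_trans _ _ (s - x)).
      by rewrite -(subrr x); apply: bl_le_add; exact: leUl.
    by rewrite ![s + _]addrC; apply: bl_le_add; exact: leUr.
  have -> : s = 2^-1 *: (s + s).
    by rewrite scalerDr -scalerDl (_ : 2^-1 + 2^-1 = 1 :> R) ?scale1r//; lra.
  by rewrite -[0](scaler0 V 2^-1); apply: bl_le_scale => //; rewrite invr_ge0.
have p0 : 0 <= (Order.join x 0 : V) by exact: leUr.
have pN : - (Order.join x 0 : V) <= 0.
  rewrite -[leLHS]add0r -[leRHS](subrr (Order.join x 0 : V)).
  exact: bl_le_add p0.
apply: bl_le_norm; rewrite bl_supP; apply/andP; split.
  by rewrite -[bl_le _ _]/(Order.join x 0 <= s) leUx leUl.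
exact: le_trans pN s0.
Qed.

Lemma dual_bounded (g : dual V) :
  exists2 r : R, 0 < r & forall x : V, `|g x| <= r * `|x|.
Proof.
have /linear_boundedP/pinfty_ex_gt0[r r0 gr] :=
  continuous_linear_bounded (f := g) 0 (@dual_continuous _ _ g 0).
by exists r.
Qed.

(** On the positive cone [v] inherits a bound from [g] and [h].  It passes to all
    of [V] through [x = x^+ - (x^+ - x)], where the two positive parts have norm
    at most [`|x|] and [2 * `|x|]. *)
Lemma linear_between_dual_continuous (g h : dual V) (v : {linear V -> R^o}) :
  (forall w : V, 0 <= w -> g w <= v w <= h w) -> continuous v.
Proof.
move=> gvh; have [r r0 gr] := dual_bounded g; have [s s0 hs] := dual_bounded h.
have vw w : 0 <= w -> `|v w| <= (r + s) * `|w|.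
  move=> /gvh /andP[gv vh].
  rewrite mulrDl ler_norml; apply/andP; split.
    have := ler_norm (- g w); rewrite normrN => H.
    have := gr w; have : 0 <= s * `|w| by rewrite mulr_ge0// ltW.
    lra.
  have := ler_norm (h w); have := hs w.
  have : 0 <= r * `|w| by rewrite mulr_ge0// ltW.
  lra.
apply: bounded_linear_continuous; apply/linear_boundedP.
near=> c => x; set p : V := Order.join x 0.
have p0 : 0 <= p by exact: leUr.
have px0 : 0 <= p - x by rewrite -(subrr x); apply: bl_le_add; exact: leUl.
have pN : `|p| <= `|x| by exact: norm_join0_le.
rewrite -[x in leLHS](subKr p) linearB.
apply: le_trans (ler_normB _ _) _.
apply: (@le_trans _ _ ((r + s) * 3 * `|x|)).
  apply: le_trans (lerD (vw _ p0) (vw _ px0)) _.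
  rewrite -mulrDr -mulrA; apply: ler_wpM2l; first by rewrite addr_ge0// ltW.
  have := ler_normB p x; lra.
apply: ler_wpM2r; first exact: normr_ge0.
by near: c; apply: nbhs_pinfty_ge; exact: num_real.
Unshelve. all: by end_near. Qed.

Lemma ultra_fmap {S T : Type} (f : S -> T) (F : set_system S) :
  UltraFilter F -> UltraFilter (f @ F).
Proof.
move=> UF; split; first exact: fmap_proper_filter.
move=> G PG FG; apply/seteqP; split => // A GA.
have [//|FnA] := in_ultra_setVsetC (f @^-1` A) UF.
by have [] := filter_ex (filterI GA (FG (~` A) FnA)) => z [].
Qed.

(** Along an ultrafilter the values at a positive vector converge because they
    eventually lie in a compact segment, and every vector is a difference of
    positive ones.  The pointwise limit is continuous since it is itself squeezed
    between two continuous functionals. *)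
Lemma order_interval_ultra_cvg {I : Type} (F : set_system I)
    (UF : UltraFilter F) (g v h : I -> dual V) (g0 h0 : dual V) :
  (g @ F --> (g0 : weak_star V)) -> (h @ F --> (h0 : weak_star V)) ->
  (forall i, g i <= v i /\ v i <= h i) ->
  exists2 v0 : dual V, v @ F --> (v0 : weak_star V) & g0 <= v0 /\ v0 <= h0.
Proof.
move=> gF hF gvh; have PF : ProperFilter F by exact: ultra_proper.
have gw w : g i w @[i --> F] --> (g0 w : R^o).
  exact: (weak_star_cvgP _ _).1 gF w.
have hw w : h i w @[i --> F] --> (h0 w : R^o).
  exact: (weak_star_cvgP _ _).1 hF w.
have gv i w : 0 <= w -> g i w <= v i w.
  exact: (dual_leP _ _).1 (gvh i).1 w.
have vh i w : 0 <= w -> v i w <= h i w.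
  exact: (dual_leP _ _).1 (gvh i).2 w.
have cvg_pos w : 0 <= w -> exists l : R^o, v i w @[i --> F] --> l.
  move=> w0; have := @segment_compact R (g0 w - 1) (h0 w + 1).
  rewrite compact_ultra => /(_ _ (ultra_fmap (fun i => v i w : R) UF)) [].
    change (\forall i \near F, v i w \in `[g0 w - 1, h0 w + 1]).
    near=> i; rewrite in_itv /=; apply/andP; split.
      apply: le_trans (gv i w w0); near: i.
      by apply: cvgr_ge (gw w) _ _; rewrite ltrBlDr ltrDl.
    apply: le_trans (vh i w w0) _; near: i.
    by apply: cvgr_le (hw w) _ _; rewrite ltrDl.
  by move=> l [_ vl]; exists l.
have /choice[l vl] w : exists l : R^o, v i w @[i --> F] --> l.
  set p : V := Order.join w 0.
  have [|a pa] := cvg_pos p; first exact: leUr.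
  have [|b pb] := cvg_pos (p - w).
    by rewrite -(subrr w); apply: bl_le_add; exact: leUl.
  exists (a - b); rewrite -[w](subKr p).
  under eq_fun do rewrite linearB.
  exact: cvgB pa pb.
have l_lin : linear l.
  move=> a x y; apply: (cvg_unique (@norm_hausdorff _ R^o) (vl _)) => /=.
  under eq_fun do rewrite linearP.
  by apply: cvgD (vl y); apply: cvgZr; exact: vl.
have glh w : 0 <= w -> g0 w <= l w <= h0 w.
  move=> w0; apply/andP; split; rewrite -subr_ge0.
    apply: (cvgr_to_ge (cvgB (vl w) (gw w))); near=> i.
    by rewrite subr_ge0; exact: gv.
  apply: (cvgr_to_ge (cvgB (hw w) (vl w))); near=> i.
  by rewrite subr_ge0; exact: vh.
pose lL := GRing.isLinear.Build R V R^o _ l l_lin.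
pose L : {linear V -> R^o} := HB.pack l lL.
have lP : l \in @dual_pred R V.
  apply/asboolP; split => //.
  exact: (linear_between_dual_continuous (v := L) glh).
exists (Dual lP).
  by apply/weak_star_cvgP => w; exact: vl.
by split; apply/dual_leP => w /glh/andP[].
Unshelve. all: by end_near. Qed.

End OrderIntervals.

(** * Existence of a minimiser *)

Theorem theorem2p1 (R : realType) (U V : banachLatticeType R)
    (A Al Au : {linear dual U -> dual V})
    (J : dual U -> \bar R) (H : dual V -> dual V -> \bar R)
    (fbar f : dual V) (delta alpha : R)
    (* standing assumptions *)
    (hA : bounded_operator A) (hAl : bounded_operator Al)
    (hAu : bounded_operator Au) (hreg : regular_operator A)
    (hlA : operator_le Al A) (hAu' : operator_le A Au)
    (hmin : exists udag, nonneg_J_minimising A J fbar udag)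
    (hdelta : (H fbar f <= delta%:E)%E) (halpha : 0 < alpha)
    (* (i) *)
    (J_ge0 : forall u, (0 <= J u)%E)
    (J_proper : proper_fun J) (J_convex : convex_efun J)
    (J_lsc : lower_semicontinuous (J : weak_star U -> \bar R))
    (J_sublevel : forall C : R, [set u | (J u <= C%:E)%E] !=set0 ->
       sequentially_compact ([set u | (J u <= C%:E)%E] : set (weak_star U)))
    (* (ii) *)
    (H_ge0 : forall v g, (0 <= H v g)%E)
    (H_proper : proper_fun (fun p : dual V * dual V => H p.1 p.2))
    (H_convex : forall g, convex_efun (H ^~ g))
    (H_lsc : lower_semicontinuous
       (fun p : weak_star V * weak_star V => H p.1 p.2))
    (H_eq0 : forall v g, H v g = 0%E <-> v = g)
    (* (iii) *)
    (A_wcont : weak_star_continuous A) (Al_wcont : weak_star_continuous Al)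
    (Au_wcont : weak_star_continuous Au) :
  exists p : dual U * dual V,
    minimiser_on
      (fun q : dual U * dual V => (alpha^-1%:E * H q.2 f + J q.1)%E)
      [set q | Al q.1 <= q.2 /\ q.2 <= Au q.1] p.
Proof.
have [udag [Audag udag0 _]] := hmin.
pose Phi (q : weak_star U * weak_star V) : \bar R :=
  (alpha^-1%:E * H q.2 f + J q.1)%E.
pose D : set (weak_star U * weak_star V) :=
  [set q | Al q.1 <= (q.2 : dual V) /\ (q.2 : dual V) <= Au q.1].
have aH0 v : (0 <= alpha^-1%:E * H v f)%E.
  by rewrite mule_ge0// lee_fin invr_ge0 ltW.
apply: (@exists_minimiser R _ Phi D).
- exists (udag, A udag) => /=.
  by split; [exact: hlA|exact: hAu'].
- by move=> q; exact: adde_ge0.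
- apply: lower_semicontinuousD.
  + by move=> q; rewrite gt_eqF// (lt_le_trans _ (aH0 _)).
  + by move=> q; rewrite gt_eqF// (lt_le_trans _ (J_ge0 _)).
  + apply: lower_semicontinuousZl; first by rewrite invr_gt0.
    apply: (@lower_semicontinuous_comp R _ _
      (fun q : weak_star U * weak_star V => (q.2, f : weak_star V)) _ _ H_lsc).
    move=> q; apply: (@cvg_pair _ _ _ (nbhs q) (nbhs q.2) (nbhs (f : weak_star V))).
      exact: cvg_snd.
    exact: cvg_cst.
  + by apply: (lower_semicontinuous_comp _ J_lsc) => q; exact: cvg_fst.
(* It remains to find a feasible cluster point of a sequence of bounded
   objective; the fidelity term is nonnegative, so J is bounded along it. *)
move=> C x xP.
have Jx n : (J (x n).1 <= C%:E)%E.
  by apply: le_trans (xP n).2; exact: leeDr.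
have [||u _ [k kmono xku]] := J_sublevel C _ (fst \o x).
- by exists (x 0%N).1; exact: Jx.
- exact: Jx.
have [G [UG ooG]] := ultraFilterLemma (_ : ProperFilter \oo).
have PG : ProperFilter G by exact: ultra_proper.
have uG : (fun n => (x (k n)).1) @ G --> (u : weak_star U).
  by move=> B /xku; exact: ooG.
have [v vG [Alv vAu]] : exists2 v : dual V,
    (fun n => (x (k n)).2) @ G --> (v : weak_star V) & Al u <= v /\ v <= Au u.
  apply: (order_interval_ultra_cvg UG (g := fun n => Al (x (k n)).1)
    (h := fun n => Au (x (k n)).1)).
  + exact: cvg_comp uG (Al_wcont u).
  + exact: cvg_comp uG (Au_wcont u).
  + by move=> n; exact: (xP (k n)).1.
exists (u, v) => //.
apply: (cluster_subseq PG ooG kmono).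
have -> : x \o k = (fun n => ((x (k n)).1, (x (k n)).2)).
  by apply: funext => n; exact: surjective_pairing.
exact: cvg_pair uG vG.
Qed.
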